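(* Let $n,k$ be integers with $0<k<n$ and let $b\in\mathbb{C}$. Then the function $\varphi=\varphi(n,k,b)$ defined by $$\varphi(z)=\frac{1}{2\pi i}\int_{C}\exp\left\{-wz+b\alpha w^{k+1}+\beta w^{n+1}\right\}\,dw,\qquad \alpha=\frac{(-1)^{k+1}}{k+1},\quad \beta=\frac{1}{n+1},$$ is a nontrivial (i.e. $\varphi\not\equiv 0$) solution $f=\varphi(z)$ of the differential equation $$f^{(n)}+(-1)^{n+1}bf^{(k)}+(-1)^{n+1}zf=0 .$$
   Context: The contour $C$ runs from $\infty$ to $0$ along the ray $\arg w=-\pi/(n+1)$ and then from $0$ to $\infty$ along the ray $\arg w=\pi/(n+1)$. Here $z\in\mathbb{C}$, and solutions are entire functions of $z$. *)

(* Defs.v *)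
From Stdlib Require Import Reals.
From Coquelicot Require Import Coquelicot.
Open Scope C_scope.

Definition Cexp (w : C) : C :=
  (exp (Re w) * cos (Im w), exp (Re w) * sin (Im w))%R.

(* F(w) dw pulled back along w = t e^(i theta), t real. *)
Definition ray_pullback (F : C -> C) (theta t : R) : C :=
  F (t * Cexp (Ci * theta)) * Cexp (Ci * theta).

Definition ray_angle (n : nat) : R := (PI / INR (n + 1))%R.

(* Convergence of the integral of F along C: on each of the two rays the
   improper Riemann integral exists.  Along the first ray the parameter t runs
   from +oo down to 0, along the second from 0 up to +oo. *)
Definition ex_contour_int (n : nat) (F : C -> C) : Prop :=
  ex_RInt_gen (V := C_R_NormedModule) (ray_pullback F (- ray_angle n))
    (Rbar_locally p_infty) (at_point 0%R) /\
  ex_RInt_gen (V := C_R_NormedModule) (ray_pullback F (ray_angle n))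
    (at_point 0%R) (Rbar_locally p_infty).

(* Meaningful only under ex_contour_int, since RInt_gen is total. *)
Definition contour_int (n : nat) (F : C -> C) : C :=
  RInt_gen (V := C_R_CompleteNormedModule) (ray_pullback F (- ray_angle n))
    (Rbar_locally p_infty) (at_point 0%R) +
  RInt_gen (V := C_R_CompleteNormedModule) (ray_pullback F (ray_angle n))
    (at_point 0%R) (Rbar_locally p_infty).

Definition alpha (k : nat) : C := (- (1)) ^ (k + 1) / INR (k + 1).

Definition beta (n : nat) : C := 1 / INR (n + 1).

Definition integrand (n k : nat) (b z w : C) : C :=
  Cexp (- w * z + b * alpha k * w ^ (k + 1) + beta n * w ^ (n + 1)).

Definition phi (n k : nat) (b z : C) : C :=
  1 / (2 * PI * Ci) * contour_int n (integrand n k b z).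

Definition entire (f : C -> C) : Prop :=
  forall z : C, ex_derive (K := C_AbsRing) (V := C_NormedModule) f z.

Fixpoint C_derive_n (f : C -> C) (m : nat) : C -> C :=
  match m with
  | O => f
  | S p => C_derive (C_derive_n f p)
  end.

(* C_derive is total, so the existence of every derivative up to order n is
   required explicitly. *)
Definition is_solution (n k : nat) (b : C) (f : C -> C) : Prop :=
  entire f /\
  (forall m : nat, (m < n)%nat -> entire (C_derive_n f m)) /\
  (forall z : C,
     C_derive_n f n z + (- (1)) ^ (n + 1) * b * C_derive_n f k z
       + (- (1)) ^ (n + 1) * z * f z = 0).

(* Main.v *)
(* Let I_m(z) be the integral of w^m exp(S(w)) along C, where S is the exponent of the
   integrand.  On both rays w^(n+1) = -t^(n+1), so each integrand is dominated by a multiple of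
   e^(-t), and |e^x - 1 - x| <= |x|^2 e^|x| gives I_m' = -I_(m+1).  The equation is the vanishing
   of the integral of S' e^S.

   If phi vanished identically, then so would every I_m(0).  Multiplying the integrand at z = 0
   by the Taylor polynomials of e^x at x = -b alpha w^(k+1), whose remainder of order N is at
   most 2^(-N) e^(2|x|), shows that the integral of exp(beta w^(n+1)) along C is 0.  But it
   equals 2i sin(pi/(n+1)) times the integral of exp(-t^(n+1)/(n+1)) over t >= 0. *)
Require Import Defs.
From Stdlib Require Import Reals Factorial Lra Lia Classical.
From Coquelicot Require Import Coquelicot.
Open Scope R_scope.

(** * Integrals over the half-line *)

(** No convergence theorem for integrals is invoked. Whenever a limit would have to pass under the
    contour integral, the error is written as a contour integral of an explicit remainder and
    bounded by a small factor times a fixed majorant [M * exp (- t)]. For the derivative in z the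
    small factor is |h|^2, for the Taylor truncation it is 2^(-N). Multiplying by e^x cancels the
    b-term of the exponent, and the Taylor polynomials of e^x are polynomials in w^(k+1), so their
    integrals against the integrand are combinations of moments. The price e^(2|x|) of a factor
    2^(-N) uniform in w is affordable because |x| grows like t^(k+1), of lower degree than the
    decaying term t^(n+1). No single value of phi is shown to be nonzero: the contradiction uses the
    vanishing of infinitely many moments at once. *)

Lemma is_RInt_exp_opp (a b : R) :
  is_RInt (fun t => exp (- t)) a b (exp (- a) - exp (- b)).
Proof.
  replace (exp (- a) - exp (- b)) with (minus (- exp (- b)) (- exp (- a)))
    by (unfold minus, plus, opp; simpl; ring).
  apply (is_RInt_derive (fun t => - exp (- t)) (fun t => exp (- t))).
  - intros x _. auto_derive; [easy | ring].
  - intros x _. apply (ex_derive_continuous (fun t => exp (- t))). auto_derive. easy.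
Qed.

Lemma plus_minus_l {G : AbelianGroup} (x y : G) : minus (plus x y) x = y.
Proof.
  unfold minus. rewrite (plus_comm x y), <- (@plus_assoc G), (@plus_opp_r G). apply plus_zero_r.
Qed.

Lemma exp_opp_small (M : R) (eps : posreal) : 0 <= M ->
  exists N, 0 <= N /\ forall x, N < x -> M * exp (- x) < eps.
Proof.
  intros HM.
  (* Since x < e^x, any x beyond M / eps has M < eps * e^x. *)
  exists (M / eps). assert (He := cond_pos eps).
  assert (0 <= M / eps) by (apply Rdiv_le_0_compat; lra).
  split; [assumption|]. intros x Hx.
  assert (H1 : x < exp x) by (generalize (exp_ineq1 x ltac:(lra)); lra).
  rewrite exp_Ropp. apply (Rmult_lt_reg_r (exp x)); [apply exp_pos|].
  rewrite Rmult_assoc, Rinv_l by (apply Rgt_not_eq, exp_pos).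
  replace (M * 1) with (eps * (M / eps)) by (field; lra).
  apply Rmult_lt_compat_l; lra.
Qed.

Section HalfLine.
Context {V : CompleteNormedModule R_AbsRing}.

Lemma norm_RInt_le_exp_opp (f : R -> V) (M a b : R) :
  0 <= a <= b -> (forall t, 0 <= t -> norm (f t) <= M * exp (- t)) ->
  ex_RInt f a b -> norm (RInt f a b) <= M * (exp (- a) - exp (- b)).
Proof.
  intros Hab Hf Hex.
  apply (norm_RInt_le f (fun t => M * exp (- t)) a b).
  - lra.
  - intros x Hx. apply Hf. lra.
  - now apply RInt_correct.
  - apply (is_RInt_scal (fun t => exp (- t)) a b M). apply is_RInt_exp_opp.
Qed.

Lemma is_RInt_gen_half_line (f : R -> V) (l : V) :
  (forall t, continuous f t) ->
  filterlim (fun x => RInt f 0 x) (Rbar_locally p_infty) (locally l) ->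
  is_RInt_gen f (at_point 0) (Rbar_locally p_infty) l.
Proof.
  intros Hf Hl P HP.
  specialize (Hl P HP). unfold filtermap in Hl.
  exists (fun a => a = 0) (fun x => P (RInt f 0 x)).
  - reflexivity.
  - exact Hl.
  - intros x y -> Hy. exists (RInt f 0 y). split; [|exact Hy].
    apply RInt_correct. apply ex_RInt_continuous. intros; apply Hf.
Qed.

(** The integral from u to v is at most M * e^(-u), so the partial integrals are Cauchy and
    completeness gives the limit. The bound M is the integral of M * e^(-t). It is stated together
    with existence because every later error estimate comes from it. *)
Lemma ex_RInt_gen_exp_dominated (f : R -> V) (M : R) :
  (forall t, continuous f t) ->
  (forall t, 0 <= t -> norm (f t) <= M * exp (- t)) ->
  exists l, is_RInt_gen f (at_point 0) (Rbar_locally p_infty) l /\ norm l <= M.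
Proof.
  intros Hc Hf.
  assert (Hi : forall a b, ex_RInt f a b).
  { intros a b. apply ex_RInt_continuous. intros; apply Hc. }
  assert (HM : 0 <= M).
  { generalize (Hf 0 (Rle_refl 0)) (norm_ge_0 (f 0)). rewrite Ropp_0, exp_0. lra. }
  assert (Hl : exists l, filterlim (fun x => RInt f 0 x) (Rbar_locally p_infty) (locally l)).
  { apply (filterlim_locally_cauchy (F := Rbar_locally p_infty)).
    intros eps. destruct (exp_opp_small M eps HM) as [N [HN HMN]].
    exists (fun x => N < x). split; [now exists N|].
    assert (Hw : forall u v, N < u -> u <= v -> norm (minus (RInt f 0 v) (RInt f 0 u)) < eps).
    { intros u v Hu Huv.
      rewrite <- (RInt_Chasles f 0 u v) by auto.
      replace (minus _ _) with (RInt f u v)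
        by (symmetry; apply (plus_minus_l (G := V))).
      eapply Rle_lt_trans; [apply (norm_RInt_le_exp_opp f M); auto; lra|].
      specialize (HMN u Hu). assert (0 <= M * exp (- v)).
      { apply Rmult_le_pos; [lra | left; apply exp_pos]. }
      lra. }
    intros u v Hu Hv. destruct (Rle_dec u v) as [H|H].
    - apply (@norm_compat1 R_AbsRing V). auto.
    - apply ball_sym, (@norm_compat1 R_AbsRing V). apply Hw; lra. }
  destruct Hl as [l Hl]. exists l. split.
  - now apply is_RInt_gen_half_line.
  - apply (filterlim_le (F := Rbar_locally p_infty) (fun x => norm (RInt f 0 x)) (fun _ => M) (norm l) M).
    + exists 0. intros x Hx.
      eapply Rle_trans; [apply (norm_RInt_le_exp_opp f M); auto; lra|].
      rewrite Ropp_0, exp_0. assert (0 <= M * exp (- x)).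
      { apply Rmult_le_pos; [lra | left; apply exp_pos]. }
      lra.
    + eapply filterlim_comp; [exact Hl|]. apply (@filterlim_norm R_AbsRing V).
    + apply filterlim_const.
Qed.

(** The fundamental theorem of calculus on the half-line: F decays at infinity, so only the boundary
    term at 0 survives. *)
Lemma is_RInt_gen_half_line_derive (F f : R -> V) (M : R) :
  (forall t, is_derive F t (f t)) -> (forall t, continuous f t) ->
  (forall t, 0 <= t -> norm (F t) <= M * exp (- t)) ->
  is_RInt_gen f (at_point 0) (Rbar_locally p_infty) (opp (F 0)).
Proof.
  intros HF Hf Hb.
  apply is_RInt_gen_half_line; [exact Hf|].
  assert (Hx : forall x, minus (F x) (F 0) = RInt f 0 x).
  { intros x. symmetry. apply is_RInt_unique. apply is_RInt_derive; auto. }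
  apply (filterlim_ext _ _ Hx).
  assert (H0 : filterlim F (Rbar_locally p_infty) (locally (zero : V))).
  { apply (filterlim_locally_ball_norm (K := R_AbsRing) (U := V)). intros eps.
    assert (HM : 0 <= M).
    { generalize (Hb 0 (Rle_refl 0)) (norm_ge_0 (F 0)). rewrite Ropp_0, exp_0. lra. }
    destruct (exp_opp_small M eps HM) as [N [HN HMN]].
    exists N. intros x Hxx. unfold ball_norm.
    eapply Rle_lt_trans; [right; apply f_equal, (minus_zero_r (G := V))|].
    eapply Rle_lt_trans; [apply Hb; lra|auto]. }
  replace (opp (F 0)) with (plus zero (opp (F 0))) by apply (plus_zero_l (G := V)).
  apply (filterlim_comp_2 (F := Rbar_locally p_infty) (G := locally (zero : V))
    (H := locally (opp (F 0))) F (fun _ => opp (F 0)) plus).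
  - exact H0.
  - apply filterlim_const.
  - apply (@filterlim_plus R_AbsRing V).
Qed.

End HalfLine.

(** Integrals live in the product module over R, estimates are stated with [Cmod]; the product norm
    squares absolute values of the components, hence the rewriting. *)
Lemma norm_C (z : C) : @norm R_AbsRing C_R_NormedModule z = Cmod z.
Proof.
  unfold norm; simpl. unfold prod_norm, Cmod. f_equal.
  now rewrite <- (pow2_abs (fst z)), <- (pow2_abs (snd z)).
Qed.

(** * Real-linear maps and the complex exponential *)

Lemma Riemann_sum_linear {U V : NormedModule R_AbsRing} (L : U -> V) (f : R -> U) (s : SF_seq) :
  is_linear L -> Riemann_sum (fun t => L (f t)) s = L (Riemann_sum f s).
Proof.
  intros HL. induction s as [x0 | h s IH] using SF_cons_ind.
  - symmetry. apply (linear_zero L HL).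
  - rewrite !Riemann_sum_cons, IH.
    now rewrite (linear_plus L HL), (linear_scal L HL).
Qed.

Lemma is_RInt_linear {U V : NormedModule R_AbsRing} (L : U -> V) (f : R -> U) (a b : R) (l : U) :
  is_linear L -> is_RInt f a b l -> is_RInt (fun t => L (f t)) a b (L l).
Proof.
  intros HL Hf. unfold is_RInt.
  apply (filterlim_ext (fun s => L (scal (sign (b - a)) (Riemann_sum f s)))).
  - intros s. now rewrite (linear_scal L HL), (Riemann_sum_linear L f s HL).
  - eapply filterlim_comp; [exact Hf|]. apply (linear_cont L l HL).
Qed.

Lemma is_RInt_gen_linear {U V : NormedModule R_AbsRing} (L : U -> V) (f : R -> U)
    (Fa Fb : (R -> Prop) -> Prop) {FFa : Filter Fa} {FFb : Filter Fb} (l : U) :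
  is_linear L -> is_RInt_gen f Fa Fb l -> is_RInt_gen (fun t => L (f t)) Fa Fb (L l).
Proof.
  intros HL Hf P HP.
  generalize (Hf _ (linear_cont L l HL P HP)).
  unfold filtermapi. apply filter_imp.
  intros ab [y [Hy HPy]]. exists (L y). split; [now apply is_RInt_linear | exact HPy].
Qed.

Lemma is_derive_linear {U V : NormedModule R_AbsRing} (L : U -> V) (f : R -> U) (t : R) (l : U) :
  is_linear L -> is_derive f t l -> is_derive (fun s => L (f s)) t (L l).
Proof.
  intros HL Hf.
  apply (filterdiff_ext_lin (K := R_AbsRing) (U := R_NormedModule) _ (fun s : R => L (scal s l))).
  - apply (filterdiff_comp' f L); [exact Hf|]. now apply filterdiff_linear.
  - intros s. apply (linear_scal L HL).
Qed.

(** [C_R_NormedModule] has real scalars only, so a complex constant is pulled out of an integral as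
    a bounded real-linear map. *)
Lemma is_linear_Cmult (c : C) :
  is_linear (K := R_AbsRing) (U := C_R_NormedModule) (V := C_R_NormedModule) (fun z => c * z)%C.
Proof.
  apply Build_is_linear.
  - intros x y. apply Cmult_plus_distr_l.
  - intros k x. unfold scal; simpl. unfold prod_scal, scal; simpl. unfold mult; simpl.
    unfold Cmult; simpl. f_equal; ring.
  - exists (Cmod c + 1). split; [generalize (Cmod_ge_0 c); lra|].
    intros x. rewrite !norm_C, Cmod_mult.
    apply Rmult_le_compat_r; [apply Cmod_ge_0 | lra].
Qed.

Lemma is_derive_C_pair (f : R -> C) (t : R) (l : C) :
  is_derive (fun s => fst (f s)) t (fst l) -> is_derive (fun s => snd (f s)) t (snd l) ->
  is_derive (V := C_R_NormedModule) f t l.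
Proof.
  intros H1 H2.
  apply (is_derive_ext (V := C_R_NormedModule) 
    (fun s => plus (scal (fst (f s)) (1, 0)) (scal (snd (f s)) (0, 1)))).
  { intros s. unfold plus, scal; simpl. unfold prod_plus, prod_scal, plus, scal; simpl.
    unfold mult; simpl. destruct (f s); simpl. f_equal; ring. }
  replace l with (plus (scal (fst l) ((1, 0) : C_R_NormedModule)) (scal (snd l) ((0, 1) : C_R_NormedModule))).
  - apply (is_derive_plus (V := C_R_NormedModule)).
    + apply (is_derive_scal_l (V := C_R_NormedModule)). exact H1.
    + apply (is_derive_scal_l (V := C_R_NormedModule)). exact H2.
  - unfold plus, scal; simpl. unfold prod_plus, prod_scal, plus, scal; simpl.
    unfold mult; simpl. destruct l; simpl. f_equal; ring.
Qed.

(** Differentiation along a real parameter suffices: [Cexp] is only ever differentiated along a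
    segment (Taylor remainder) or along a ray (exact derivative). *)
Lemma is_derive_Cexp_comp (g : R -> C) (t : R) (l : C) :
  is_derive (V := C_R_NormedModule) g t l ->
  is_derive (V := C_R_NormedModule) (fun s => Cexp (g s)) t (l * Cexp (g t))%C.
Proof.
  intros Hg.
  assert (H1 : is_derive (fun s => fst (g s)) t (fst l)).
  { apply (is_derive_linear (U := C_R_NormedModule) (V := R_NormedModule) (fun z => fst z)).
    - apply (is_linear_fst (U := R_NormedModule) (V := R_NormedModule)).
    - exact Hg. }
  assert (H2 : is_derive (fun s => snd (g s)) t (snd l)).
  { apply (is_derive_linear (U := C_R_NormedModule) (V := R_NormedModule) (fun z => snd z)).
    - apply (is_linear_snd (U := R_NormedModule) (V := R_NormedModule)).
    - exact Hg. }
  assert (HA : forall (u v : R -> R) (du dv : R), is_derive u t du -> is_derive v t dv ->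
    is_derive (fun s => exp (u s) * cos (v s)) t
      (du * (exp (u t) * cos (v t)) - dv * (exp (u t) * sin (v t))) /\
    is_derive (fun s => exp (u s) * sin (v s)) t
      (du * (exp (u t) * sin (v t)) + dv * (exp (u t) * cos (v t)))).
  { intros u v du dv Hu Hv. split.
    all: auto_derive; [split; [eexists; exact Hu | split; [eexists; exact Hv | exact I]]|].
    all: replace (Derive (fun x : R => u x) t) with du by (symmetry; now apply is_derive_unique).
    all: replace (Derive (fun x : R => v x) t) with dv by (symmetry; now apply is_derive_unique).
    all: ring. }
  destruct (HA _ _ _ _ H1 H2). now apply is_derive_C_pair.
Qed.

Lemma Cmod_Cexp (w : C) : Cmod (Cexp w) = exp (Re w).
Proof.
  unfold Cmod, Cexp; simpl.
  replace (_ + _) with ((exp (Re w))² * ((sin (Im w))² + (cos (Im w))²))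
    by (unfold Rsqr; ring).
  rewrite sin2_cos2, Rmult_1_r. apply sqrt_Rsqr. left; apply exp_pos.
Qed.

Lemma Cexp_plus (u v : C) : Cexp (u + v) = (Cexp u * Cexp v)%C.
Proof.
  unfold Cexp, Cmult, Cplus, Re, Im; simpl.
  rewrite exp_plus, cos_plus, sin_plus. f_equal; ring.
Qed.

Lemma Cexp_0 : Cexp 0 = 1%C.
Proof. unfold Cexp; simpl. rewrite exp_0, cos_0, sin_0. unfold RtoC. f_equal; ring. Qed.

(** * Taylor remainder of the complex exponential *)

(* [ring] does not see through the carrier of [C_R_NormedModule]. *)
Ltac C_eq := match goal with |- @eq _ ?a ?b => change (@eq C a b) end.

(** N is the number of terms, so the degree stays below N. With this indexing the remainder
    [Cexp_rem N] has order N, [Cexp_rem 0] is [Cexp] itself, and differentiating along a segment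
    lowers the index by one. *)
Fixpoint Cexp_sum (N : nat) (x : C) : C :=
  match N with
  | O => 0
  | S m => Cexp_sum m x + x ^ m / INR (fact m)
  end%C.

Lemma is_derive_line (x : C) (t : R) :
  is_derive (V := C_R_NormedModule) (fun s : R => s * x)%C t x.
Proof.
  apply is_derive_C_pair; simpl.
  - replace (fst x) with (1 * fst x - 0 * snd x) at 2 by ring. auto_derive; [easy | ring].
  - auto_derive; [easy | ring].
Qed.

Lemma is_derive_line_pow (c : C) (m : nat) (t : R) :
  is_derive (V := C_R_NormedModule) (fun s : R => s ^ S m * c)%C t (INR (S m) * t ^ m * c)%C.
Proof.
  apply (is_derive_ext (V := C_R_NormedModule) (fun s : R => scal (s ^ S m) (c : C_R_NormedModule))).
  { intros s. rewrite <- RtoC_pow. unfold scal; simpl. unfold prod_scal, scal; simpl.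
    unfold mult, Cmult; simpl. f_equal; ring. }
  replace (INR (S m) * t ^ m * c)%C with (scal (INR (S m) * t ^ m) (c : C_R_NormedModule)).
  - apply (is_derive_scal_l (V := C_R_NormedModule)).
    auto_derive; [easy|]. change (1 * (INR (S m) * t ^ m) = INR (S m) * t ^ m). ring.
  - rewrite <- RtoC_pow, <- RtoC_mult. unfold scal; simpl. unfold prod_scal, scal; simpl.
    unfold mult, Cmult; simpl. f_equal; ring.
Qed.

Lemma Cinv_fact_S (N : nat) : (INR (S N) / INR (fact (S N)) = 1 / INR (fact N))%C.
Proof.
  rewrite fact_simpl, mult_INR, RtoC_mult. field. split; intros H; apply RtoC_inj in H.
  - now apply INR_fact_neq_0 in H.
  - revert H. apply not_0_INR. lia.
Qed.

Lemma is_derive_Cexp_sum_line (N : nat) (x : C) (t : R) :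
  is_derive (V := C_R_NormedModule) (fun s : R => Cexp_sum (S N) (s * x))%C t
    (x * Cexp_sum N (t * x))%C.
Proof.
  induction N as [|N IH].
  - simpl. replace (x * 0)%C with (zero : C_R_NormedModule) by (rewrite Cmult_0_r; reflexivity).
    apply (is_derive_const (V := C_R_NormedModule)).
  - change (is_derive (V := C_R_NormedModule)
      (fun s : R => Cexp_sum (S N) (s * x) + (s * x) ^ S N / INR (fact (S N)))%C t
      (x * (Cexp_sum N (t * x) + (t * x) ^ N / INR (fact N)))%C).
    replace (x * (Cexp_sum N (t * x) + (t * x) ^ N / INR (fact N)))%C
      with (x * Cexp_sum N (t * x) + INR (S N) * t ^ N * (x ^ S N / INR (fact (S N))))%C.
    + apply (is_derive_plus (V := C_R_NormedModule)); [exact IH|].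
      apply (is_derive_ext (V := C_R_NormedModule)
        (fun s : R => s ^ S N * (x ^ S N / INR (fact (S N))))%C).
      * intros s. rewrite Cpow_mult_l. unfold Cdiv. C_eq. ring.
      * apply is_derive_line_pow.
    + replace (INR (S N) * t ^ N * (x ^ S N / INR (fact (S N))))%C
        with (x * (t * x) ^ N * (INR (S N) / INR (fact (S N))))%C
        by (rewrite Cpow_mult_l, (Cpow_S x N); unfold Cdiv; ring).
      rewrite Cinv_fact_S. unfold Cdiv. ring.
Qed.

Definition Cexp_rem (N : nat) (x : C) : C := (Cexp x - Cexp_sum N x)%C.

Lemma is_derive_Cexp_line (x : C) (t : R) :
  is_derive (V := C_R_NormedModule) (fun s : R => Cexp (s * x)%C) t (x * Cexp (t * x))%C.
Proof. apply (is_derive_Cexp_comp (fun s : R => s * x)%C), is_derive_line. Qed.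

Lemma is_derive_Cexp_rem_line (N : nat) (x : C) (t : R) :
  is_derive (V := C_R_NormedModule) (fun s : R => Cexp_rem (S N) (s * x))%C t
    (x * Cexp_rem N (t * x))%C.
Proof.
  unfold Cexp_rem.
  replace (x * (Cexp (t * x) - Cexp_sum N (t * x)))%C
    with (x * Cexp (t * x) - x * Cexp_sum N (t * x))%C by ring.
  apply (is_derive_minus (V := C_R_NormedModule)).
  - apply is_derive_Cexp_line.
  - apply is_derive_Cexp_sum_line.
Qed.

Lemma continuous_Cexp_rem_line (N : nat) (x : C) (t : R) :
  continuous (U := C_R_NormedModule) (fun s : R => Cexp_rem N (s * x))%C t.
Proof.
  apply (ex_derive_continuous (V := C_R_NormedModule)). destruct N as [|N].
  - exists (x * Cexp (t * x))%C.
    apply (is_derive_ext (V := C_R_NormedModule) (fun s : R => Cexp (s * x)%C)).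
    + intros s. unfold Cexp_rem; simpl. C_eq. ring.
    + apply is_derive_Cexp_line.
  - eexists. apply is_derive_Cexp_rem_line.
Qed.

Lemma Cexp_rem_S_0 (N : nat) : Cexp_rem (S N) 0 = 0%C.
Proof.
  unfold Cexp_rem. rewrite Cexp_0. induction N as [|N IH].
  - simpl. field.
  - change (1 - (Cexp_sum (S N) 0 + 0 ^ S N / INR (fact (S N))) = 0)%C.
    rewrite Cpow_S. unfold Cdiv. rewrite Cmult_0_l, Cmult_0_l, Cplus_0_r. exact IH.
Qed.

(* [Cexp_rem (S N) x] is the integral of [x * Cexp_rem N (t * x)] over [0 <= t <= 1]. *)
Lemma Cmod_Cexp_rem_S (N : nat) (x : C) (g : R -> R) (K : R) :
  (forall t, 0 <= t <= 1 -> Cmod x * Cmod (Cexp_rem N (t * x)) <= g t) ->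
  is_RInt g 0 1 K -> Cmod (Cexp_rem (S N) x) <= K.
Proof.
  intros Hg HK.
  replace (Cexp_rem (S N) x) with
    (minus (Cexp_rem (S N) (1%R * x)%C : C_R_CompleteNormedModule) (Cexp_rem (S N) (0%R * x)%C)).
  - rewrite <- norm_C.
    apply (norm_RInt_le (V := C_R_CompleteNormedModule)
      (fun t : R => x * Cexp_rem N (t * x))%C g 0 1); [lra| |  | exact HK].
    + intros t Ht. eapply Rle_trans; [right; apply norm_C|]. rewrite Cmod_mult. auto.
    + apply (is_RInt_derive (V := C_R_CompleteNormedModule) (fun t : R => Cexp_rem (S N) (t * x))%C).
      * intros t _. apply is_derive_Cexp_rem_line.
      * intros t _. apply (continuous_comp (V := C_R_NormedModule) (W := C_R_NormedModule)
          (fun t : R => Cexp_rem N (t * x))%C (fun z => x * z)%C).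
        -- apply continuous_Cexp_rem_line.
        -- apply (linear_cont (U := C_R_NormedModule) (V := C_R_NormedModule)), is_linear_Cmult.
  - rewrite Cmult_0_l, Cmult_1_l, Cexp_rem_S_0.
    change (Cexp_rem (S N) x - 0 = Cexp_rem (S N) x)%C. ring.
Qed.

Lemma Cmod_Cexp_le (x : C) : Cmod (Cexp x) <= exp (Cmod x).
Proof.
  rewrite Cmod_Cexp.
  assert (H : Re x <= Cmod x) by (eapply Rle_trans; [apply Rle_abs | apply re_le_Cmod]).
  destruct H as [H | ->]; [left; now apply exp_increasing | lra].
Qed.

Lemma exp_le (x y : R) : x <= y -> exp x <= exp y.
Proof. intros [H | ->]; [left; now apply exp_increasing | lra]. Qed.

Lemma Cmod_RtoC_mult (t : R) (x : C) : 0 <= t -> Cmod (t * x) = t * Cmod x.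
Proof. intros Ht. rewrite Cmod_mult, Cmod_R, Rabs_pos_eq; auto. Qed.

Lemma Cexp_rem_0 (x : C) : Cexp_rem 0 x = Cexp x.
Proof. unfold Cexp_rem; simpl. ring. Qed.

(** On the segment, the bound of order N at t * x is at most its value at t = 1, so a constant
    majorant is integrated. The lost factor 1/N! is harmless: order 2 is what the difference
    quotients of the moments need. *)
Lemma Cexp_rem_le_pow (N : nat) (x : C) :
  Cmod (Cexp_rem N x) <= Cmod x ^ N * exp (Cmod x).
Proof.
  revert x. induction N as [|N IH]; intros x.
  - rewrite Cexp_rem_0, pow_O, Rmult_1_l. apply Cmod_Cexp_le.
  - apply (Cmod_Cexp_rem_S N x (fun _ => Cmod x ^ S N * exp (Cmod x))).
    + intros t Ht. simpl. rewrite Rmult_assoc.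
      apply Rmult_le_compat_l; [apply Cmod_ge_0|].
      eapply Rle_trans; [apply IH|]. rewrite Cmod_RtoC_mult by lra.
      assert (H := Cmod_ge_0 x).
      apply Rmult_le_compat; [apply pow_le; nra | left; apply exp_pos | |].
      * apply pow_incr. nra.
      * apply exp_le. nra.
    + generalize (Cmod x ^ S N * exp (Cmod x)). intros K.
      assert (H := is_RInt_const (V := R_NormedModule) 0 1 K).
      assert (E : scal (1 - 0) (K : R_NormedModule) = K)
        by (unfold scal; simpl; unfold mult; simpl; ring).
      rewrite E in H. exact H.
Qed.

(** Integrating |x| e^(2|x|t) over [0,1] gives at most e^(2|x|)/2, so each order gains a factor 1/2.
    The 2 in the exponent buys this decay in N, uniform in x apart from the factor e^(2|x|). *)
Lemma Cexp_rem_le_geom (N : nat) (x : C) :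
  Cmod (Cexp_rem N x) <= (/ 2) ^ N * exp (2 * Cmod x).
Proof.
  revert x. induction N as [|N IH]; intros x.
  - rewrite Cexp_rem_0, pow_O, Rmult_1_l. eapply Rle_trans; [apply Cmod_Cexp_le|].
    apply exp_le. generalize (Cmod_ge_0 x). lra.
  - apply Rle_trans with ((/ 2) ^ S N * exp (2 * Cmod x * 1) - (/ 2) ^ S N * exp (2 * Cmod x * 0)).
    + apply (Cmod_Cexp_rem_S N x (fun t => Cmod x * ((/ 2) ^ N * exp (2 * Cmod x * t)))).
      * intros t Ht. apply Rmult_le_compat_l; [apply Cmod_ge_0|].
        eapply Rle_trans; [apply IH|]. rewrite Cmod_RtoC_mult by lra.
        right. f_equal. f_equal. ring.
      * apply (is_RInt_derive (fun t => (/ 2) ^ S N * exp (2 * Cmod x * t))).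
        -- intros t _. auto_derive; [easy|]. simpl. field.
        -- intros t _. apply (ex_derive_continuous (V := R_NormedModule)). auto_derive. easy.
    + rewrite Rmult_1_r. assert (0 < (/ 2) ^ S N * exp (2 * Cmod x * 0)).
      { apply Rmult_lt_0_compat; [apply pow_lt; lra | apply exp_pos]. }
      lra.
Qed.

(** * Integrals along the contour *)

Lemma continuous_C_pair (f : R -> C) (t : R) :
  continuous (fun s => fst (f s)) t -> continuous (fun s => snd (f s)) t ->
  continuous (U := C_R_NormedModule) f t.
Proof.
  intros H1 H2.
  apply (continuous_ext (U := C_R_NormedModule)
    (fun s => plus (scal (fst (f s)) ((1, 0) : C_R_NormedModule))
                   (scal (snd (f s)) ((0, 1) : C_R_NormedModule)))).
  { intros s. unfold plus, scal; simpl. unfold prod_plus, prod_scal, plus, scal; simpl.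
    unfold mult; simpl. destruct (f s); simpl. f_equal; ring. }
  apply (continuous_plus (V := C_R_NormedModule)); apply (continuous_scal_l (V := C_R_NormedModule));
    assumption.
Qed.

Lemma continuous_C_fst (f : R -> C) (t : R) :
  continuous (U := C_R_NormedModule) f t -> continuous (fun s => fst (f s)) t.
Proof.
  intros H. apply (continuous_comp (V := C_R_NormedModule) f (fun z => fst z) t H).
  apply continuous_fst.
Qed.

Lemma continuous_C_snd (f : R -> C) (t : R) :
  continuous (U := C_R_NormedModule) f t -> continuous (fun s => snd (f s)) t.
Proof.
  intros H. apply (continuous_comp (V := C_R_NormedModule) f (fun z => snd z) t H).
  apply continuous_snd.
Qed.

Lemma continuous_Cmult (f g : R -> C) (t : R) :
  continuous (U := C_R_NormedModule) f t -> continuous (U := C_R_NormedModule) g t ->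
  continuous (U := C_R_NormedModule) (fun s => f s * g s)%C t.
Proof.
  intros Hf Hg.
  assert (f1 := continuous_C_fst _ _ Hf). assert (f2 := continuous_C_snd _ _ Hf).
  assert (g1 := continuous_C_fst _ _ Hg). assert (g2 := continuous_C_snd _ _ Hg).
  apply continuous_C_pair; simpl.
  - apply (continuous_minus (V := R_NormedModule));
      apply (continuous_mult (K := R_AbsRing)); assumption.
  - apply (continuous_plus (V := R_NormedModule));
      apply (continuous_mult (K := R_AbsRing)); assumption.
Qed.

Lemma continuous_Cplus (f g : R -> C) (t : R) :
  continuous (U := C_R_NormedModule) f t -> continuous (U := C_R_NormedModule) g t ->
  continuous (U := C_R_NormedModule) (fun s => f s + g s)%C t.
Proof. apply (continuous_plus (V := C_R_NormedModule)). Qed.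

Lemma continuous_Cpow (f : R -> C) (m : nat) (t : R) :
  continuous (U := C_R_NormedModule) f t ->
  continuous (U := C_R_NormedModule) (fun s => f s ^ m)%C t.
Proof.
  intros Hf. induction m as [|m IH].
  - apply (continuous_const (U := R_UniformSpace) (V := C_R_NormedModule)).
  - apply (continuous_Cmult f); assumption.
Qed.

Lemma continuous_Cexp (f : R -> C) (t : R) :
  continuous (U := C_R_NormedModule) f t ->
  continuous (U := C_R_NormedModule) (fun s => Cexp (f s)) t.
Proof.
  intros Hf. assert (f1 := continuous_C_fst _ _ Hf). assert (f2 := continuous_C_snd _ _ Hf).
  apply continuous_C_pair; unfold Cexp, Re, Im; simpl;
    apply (continuous_mult (K := R_AbsRing)).
  1, 3: apply (continuous_comp (fun s => fst (f s)) exp); [assumption | apply continuous_exp].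
  - apply (continuous_comp (fun s => snd (f s)) cos); [assumption | apply continuous_cos].
  - apply (continuous_comp (fun s => snd (f s)) sin); [assumption | apply continuous_sin].
Qed.

Definition direction (theta : R) : C := Cexp (Ci * theta).

Lemma Cmod_direction (theta : R) : Cmod (direction theta) = 1.
Proof.
  unfold direction. rewrite Cmod_Cexp. unfold Re; simpl.
  replace (0 * theta - 1 * 0) with 0 by ring. apply exp_0.
Qed.

Lemma direction_pow (theta : R) (m : nat) :
  (direction theta ^ m = direction (INR m * theta))%C.
Proof.
  unfold direction. induction m as [|m IH].
  - simpl. rewrite <- Cexp_0. f_equal. rewrite Rmult_0_l. ring.
  - rewrite Cpow_S, IH, <- Cexp_plus, S_INR. f_equal.
    rewrite !RtoC_mult, RtoC_plus. ring.
Qed.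

Lemma direction_value (theta : R) : direction theta = (cos theta, sin theta).
Proof.
  unfold direction, Cexp, Re, Im; simpl.
  replace (0 * theta - 1 * 0) with 0 by ring. rewrite exp_0.
  replace (0 * 0 + 1 * theta) with theta by ring. f_equal; ring.
Qed.

Definition is_ray_angle (n : nat) (theta : R) : Prop :=
  theta = - ray_angle n \/ theta = ray_angle n.

Lemma direction_ray_pow (n : nat) (theta : R) :
  is_ray_angle n theta -> (direction theta ^ (n + 1) = - (1))%C.
Proof.
  intros H. rewrite direction_pow, direction_value.
  assert (Hn : INR (n + 1) <> 0) by (apply not_0_INR; lia).
  destruct H as [-> | ->]; unfold ray_angle.
  - replace (INR (n + 1) * - (PI / INR (n + 1))) with (- PI) by (field; exact Hn).
    rewrite cos_neg, sin_neg, cos_PI, sin_PI. unfold Copp, RtoC; simpl. f_equal; ring.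
  - replace (INR (n + 1) * (PI / INR (n + 1))) with PI by (field; exact Hn).
    rewrite cos_PI, sin_PI. unfold Copp, RtoC; simpl. f_equal; ring.
Qed.

(** Continuity along lines through 0 is all that integration along the rays needs, and it is closed
    under the operations that build the integrand. *)
Definition ray_continuous (F : C -> C) : Prop :=
  forall theta t : R,
    continuous (U := C_R_NormedModule) (fun s : R => F (s * direction theta)%C) t.

Lemma ray_continuous_pow (m : nat) : ray_continuous (fun w => w ^ m)%C.
Proof.
  intros theta t. apply (continuous_Cpow (fun s : R => s * direction theta)%C).
  apply (ex_derive_continuous (V := C_R_NormedModule)).
  eexists. apply is_derive_line.
Qed.

Lemma ray_continuous_const (c : C) : ray_continuous (fun _ => c).
Proof.
  intros theta t. apply (continuous_const (U := R_UniformSpace) (V := C_R_NormedModule)).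
Qed.

Lemma ray_continuous_mult (F G : C -> C) :
  ray_continuous F -> ray_continuous G -> ray_continuous (fun w => F w * G w)%C.
Proof.
  intros HF HG theta t.
  apply (continuous_Cmult (fun s : R => F (s * direction theta)%C)
    (fun s : R => G (s * direction theta)%C)); [apply HF | apply HG].
Qed.

Lemma ray_continuous_plus (F G : C -> C) :
  ray_continuous F -> ray_continuous G -> ray_continuous (fun w => F w + G w)%C.
Proof.
  intros HF HG theta t.
  apply (continuous_Cplus (fun s : R => F (s * direction theta)%C)
    (fun s : R => G (s * direction theta)%C)); [apply HF | apply HG].
Qed.

Lemma ray_continuous_Cexp (F : C -> C) :
  ray_continuous F -> ray_continuous (fun w => Cexp (F w)).
Proof.
  intros HF theta t.
  apply (continuous_Cexp (fun s : R => F (s * direction theta)%C)). apply HF.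
Qed.

Lemma ray_continuous_ext (F G : C -> C) :
  (forall w, F w = G w) -> ray_continuous F -> ray_continuous G.
Proof.
  intros H HF theta t. specialize (HF theta t). revert HF.
  apply (continuous_ext (U := C_R_NormedModule)). intros s. apply H.
Qed.

Lemma ray_continuous_Cexp_sum (N : nat) (F : C -> C) :
  ray_continuous F -> ray_continuous (fun w => Cexp_sum N (F w)).
Proof.
  intros HF. induction N as [|N IH]; simpl; [apply ray_continuous_const|].
  apply ray_continuous_plus; [exact IH|].
  apply ray_continuous_mult; [|apply ray_continuous_const].
  intros theta t. apply (continuous_Cpow (fun s : R => F (s * direction theta)%C)). apply HF.
Qed.

Lemma ray_continuous_Cexp_rem (N : nat) (F : C -> C) :
  ray_continuous F -> ray_continuous (fun w => Cexp_rem N (F w)).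
Proof.
  intros HF.
  apply (ray_continuous_ext (fun w => Cexp (F w) + (- (1)) * Cexp_sum N (F w))%C).
  { intros w. unfold Cexp_rem. ring. }
  apply ray_continuous_plus; [now apply ray_continuous_Cexp|].
  apply ray_continuous_mult; [apply ray_continuous_const | now apply ray_continuous_Cexp_sum].
Qed.

(* Both rays are parametrized outwards, whence the sign of [l1]. *)
Definition is_contour_int (n : nat) (F : C -> C) (l : C) : Prop :=
  exists l1 l2 : C,
    is_RInt_gen (V := C_R_NormedModule) (ray_pullback F (- ray_angle n))
      (at_point 0) (Rbar_locally p_infty) l1 /\
    is_RInt_gen (V := C_R_NormedModule) (ray_pullback F (ray_angle n))
      (at_point 0) (Rbar_locally p_infty) l2 /\
    l = (l2 - l1)%C.

Section Contour.
Context (n : nat).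

Lemma is_contour_int_ex (F : C -> C) (l : C) :
  is_contour_int n F l -> ex_contour_int n F.
Proof.
  intros (l1 & l2 & H1 & H2 & _). split.
  - eexists. apply is_RInt_gen_swap. exact H1.
  - eexists. exact H2.
Qed.

Lemma is_contour_int_unique (F : C -> C) (l : C) :
  is_contour_int n F l -> contour_int n F = l.
Proof.
  intros (l1 & l2 & H1 & H2 & ->). unfold contour_int.
  apply is_RInt_gen_swap in H1.
  apply (is_RInt_gen_unique (V := C_R_CompleteNormedModule)) in H1.
  apply (is_RInt_gen_unique (V := C_R_CompleteNormedModule)) in H2.
  rewrite H1, H2. change (- l1 + l2 = l2 - l1)%C. ring.
Qed.

Lemma is_contour_int_ext (F G : C -> C) (l : C) :
  (forall w, F w = G w) -> is_contour_int n F l -> is_contour_int n G l.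
Proof.
  intros HFG (l1 & l2 & H1 & H2 & ->). exists l1, l2.
  split; [|split; [|reflexivity]].
  - revert H1. apply (is_RInt_gen_ext (V := C_R_NormedModule)).
    apply filter_forall. intros ab x _. unfold ray_pullback. now rewrite HFG.
  - revert H2. apply (is_RInt_gen_ext (V := C_R_NormedModule)).
    apply filter_forall. intros ab x _. unfold ray_pullback. now rewrite HFG.
Qed.

Lemma is_contour_int_plus (F G : C -> C) (l l' : C) :
  is_contour_int n F l -> is_contour_int n G l' ->
  is_contour_int n (fun w => F w + G w)%C (l + l')%C.
Proof.
  intros (l1 & l2 & H1 & H2 & ->) (l1' & l2' & H1' & H2' & ->).
  exists (l1 + l1')%C, (l2 + l2')%C. split; [|split; [|ring]].
  - assert (H := is_RInt_gen_plus (V := C_R_NormedModule) _ _ _ _ H1 H1').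
    revert H. apply (is_RInt_gen_ext (V := C_R_NormedModule)).
    apply filter_forall. intros ab x _. unfold ray_pullback.
    rewrite Cmult_plus_distr_r. reflexivity.
  - assert (H := is_RInt_gen_plus (V := C_R_NormedModule) _ _ _ _ H2 H2').
    revert H. apply (is_RInt_gen_ext (V := C_R_NormedModule)).
    apply filter_forall. intros ab x _. unfold ray_pullback.
    rewrite Cmult_plus_distr_r. reflexivity.
Qed.

Lemma is_contour_int_scal (c : C) (F : C -> C) (l : C) :
  is_contour_int n F l -> is_contour_int n (fun w => c * F w)%C (c * l)%C.
Proof.
  intros (l1 & l2 & H1 & H2 & ->).
  exists (c * l1)%C, (c * l2)%C. split; [|split; [|ring]].
  - assert (H := is_RInt_gen_linear _ _ _ _ _ (is_linear_Cmult c) H1).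
    revert H. apply (is_RInt_gen_ext (V := C_R_NormedModule)).
    apply filter_forall. intros ab x _. unfold ray_pullback. apply Cmult_assoc.
  - assert (H := is_RInt_gen_linear _ _ _ _ _ (is_linear_Cmult c) H2).
    revert H. apply (is_RInt_gen_ext (V := C_R_NormedModule)).
    apply filter_forall. intros ab x _. unfold ray_pullback. apply Cmult_assoc.
Qed.

Lemma continuous_ray_pullback (F : C -> C) (theta t : R) :
  ray_continuous F -> continuous (U := C_R_NormedModule) (ray_pullback F theta) t.
Proof.
  intros HF. apply (continuous_Cmult (fun s : R => F (s * direction theta)%C)).
  - apply HF.
  - apply (continuous_const (U := R_UniformSpace) (V := C_R_NormedModule)).
Qed.

(** The factor dw/dt has modulus 1, so each ray contributes at most M. *)
Lemma ex_contour_int_dominated (F : C -> C) (M : R) :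
  ray_continuous F ->
  (forall theta t, is_ray_angle n theta -> 0 <= t ->
    Cmod (F (t * direction theta)%C) <= M * exp (- t)) ->
  exists l, is_contour_int n F l /\ Cmod l <= 2 * M.
Proof.
  intros HF HM.
  assert (H : forall theta, is_ray_angle n theta -> exists l,
    is_RInt_gen (V := C_R_NormedModule) (ray_pullback F theta)
      (at_point 0) (Rbar_locally p_infty) l /\ Cmod l <= M).
  { intros theta Ht.
    destruct (ex_RInt_gen_exp_dominated (V := C_R_CompleteNormedModule)
      (ray_pullback F theta) M) as [l [H1 H2]].
    - intros t. now apply continuous_ray_pullback.
    - intros t Ht0. eapply Rle_trans; [right; apply norm_C|].
      unfold ray_pullback. fold (direction theta).
      rewrite Cmod_mult, Cmod_direction, Rmult_1_r. auto.
    - exists l. split; [exact H1|]. rewrite <- norm_C. exact H2. }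
  destruct (H (- ray_angle n)) as [l1 [H1 B1]]; [now left|].
  destruct (H (ray_angle n)) as [l2 [H2 B2]]; [now right|].
  exists (l2 - l1)%C. split; [now exists l1, l2|].
  eapply Rle_trans; [apply Cmod_triangle|]. rewrite Cmod_opp. lra.
Qed.

Lemma is_contour_int_eq (F : C -> C) (l l' : C) :
  is_contour_int n F l -> is_contour_int n F l' -> l = l'.
Proof.
  intros H H'. now rewrite <- (is_contour_int_unique F l H), <- (is_contour_int_unique F l' H').
Qed.

Lemma Cmod_contour_int_le (F : C -> C) (M : R) (l : C) :
  ray_continuous F ->
  (forall theta t, is_ray_angle n theta -> 0 <= t ->
    Cmod (F (t * direction theta)%C) <= M * exp (- t)) ->
  is_contour_int n F l -> Cmod l <= 2 * M.
Proof.
  intros HF HM Hl. destruct (ex_contour_int_dominated F M HF HM) as [l' [H1 H2]].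
  now rewrite (is_contour_int_eq F l l' Hl H1).
Qed.

(** Both rays, taken outwards from 0, give the same integral -G(0), and the contour subtracts one
    from the other. *)
Lemma is_contour_int_derive (G F : C -> C) (M : R) :
  (forall theta t, is_derive (V := C_R_NormedModule) (fun s : R => G (s * direction theta)%C) t
    (F (t * direction theta) * direction theta)%C) ->
  ray_continuous F ->
  (forall theta t, is_ray_angle n theta -> 0 <= t ->
    Cmod (G (t * direction theta)%C) <= M * exp (- t)) ->
  is_contour_int n F 0.
Proof.
  intros HG HF HM.
  assert (H : forall theta, is_ray_angle n theta ->
    is_RInt_gen (V := C_R_NormedModule) (ray_pullback F theta)
      (at_point 0) (Rbar_locally p_infty) (- G 0)%C).
  { intros theta Ht. replace (- G 0)%C with (- G (0%R * direction theta))%C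
      by (rewrite Cmult_0_l; reflexivity).
    apply (is_RInt_gen_half_line_derive (V := C_R_CompleteNormedModule)
      (fun s : R => G (s * direction theta)%C) (ray_pullback F theta) M).
    - intros t. apply HG.
    - intros t. now apply continuous_ray_pullback.
    - intros t Ht0. eapply Rle_trans; [right; apply norm_C|]. auto. }
  exists (- G 0)%C, (- G 0)%C. split; [apply H; now left|split; [apply H; now right | ring]].
Qed.

End Contour.

(** * Moments of the integrand *)

Lemma pow_le_exp (m : nat) (t : R) : 0 <= t -> t ^ m <= exp (INR m * t).
Proof.
  intros Ht. induction m as [|m IH].
  - simpl. rewrite Rmult_0_l, exp_0. lra.
  - rewrite S_INR, Rmult_plus_distr_r, exp_plus, Rmult_1_l, <- tech_pow_Rmult, (Rmult_comm t).
    apply Rmult_le_compat; [now apply pow_le | assumption | assumption |].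
    destruct Ht as [Ht | <-]; [|rewrite exp_0; lra].
    generalize (exp_ineq1 t ltac:(lra)). lra.
Qed.

Lemma pow_le_1_plus_pow (j m : nat) (t : R) : (j <= m)%nat -> 0 <= t -> t ^ j <= 1 + t ^ m.
Proof.
  intros Hj Ht. destruct (Rle_dec t 1) as [H|H].
  - assert (t ^ j <= 1) by (rewrite <- (pow1 j); apply pow_incr; lra).
    generalize (pow_le t m Ht). lra.
  - generalize (Rle_pow t j m ltac:(lra) Hj). lra.
Qed.

(** Since k + 1 <= n, the powers t and t^(k+1) are both at most 1 + t^n, and t^m is at most e^(mt).
    Everything then reduces to bounding D t^n - t^(n+1)/(n+1) from above. *)
Lemma exp_poly_dominated (n k m : nat) (A B : R) :
  (k < n)%nat -> 0 <= A -> 0 <= B ->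
  exists M, 0 <= M /\ forall t, 0 <= t ->
    t ^ m * exp (A * t + B * t ^ (k + 1) - t ^ (n + 1) / INR (n + 1)) <= M * exp (- t).
Proof.
  intros Hk HA HB.
  (* The coefficients of all terms of degree at most n; the summand 1 pays for the factor e^(-t) in
     the conclusion. *)
  set (D := A + INR m + 1 + B).
  assert (HD : 0 < D) by (unfold D; generalize (pos_INR m); lra).
  assert (HN : 0 < INR (n + 1)) by (apply lt_0_INR; lia).
  exists (exp (D + D * (D * INR (n + 1)) ^ n)). split; [left; apply exp_pos|].
  intros t Ht.
  eapply Rle_trans.
  { apply Rmult_le_compat_r; [left; apply exp_pos | now apply (pow_le_exp m)]. }
  rewrite <- !exp_plus. apply exp_le.
  assert (H1 := pow_le_1_plus_pow 1 n t ltac:(lia) Ht). rewrite pow_1 in H1.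
  assert (H2 := pow_le_1_plus_pow (k + 1) n t ltac:(lia) Ht).
  assert (H3 : D * t ^ n - t ^ (n + 1) / INR (n + 1) <= D * (D * INR (n + 1)) ^ n).
  { assert (Hp := pow_le t n Ht).
    (* The left side changes sign at t = D(n+1): below that point the negative term is dropped,
       above it the whole expression is negative. *)
    rewrite pow_add, pow_1.
    destruct (Rle_dec t (D * INR (n + 1))) as [H|H].
    - assert (t ^ n <= (D * INR (n + 1)) ^ n) by (apply pow_incr; lra).
      assert (0 <= t ^ n * t / INR (n + 1)) by (apply Rdiv_le_0_compat; nra).
      nra.
    - apply Rle_trans with 0.
      + replace (D * t ^ n - t ^ n * t / INR (n + 1))
          with (- (t ^ n * (t - D * INR (n + 1)) / INR (n + 1))) by (field; lra).
        assert (0 <= t ^ n * (t - D * INR (n + 1)) / INR (n + 1))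
          by (apply Rdiv_le_0_compat; [nra | lra]).
        lra.
      + apply Rmult_le_pos; [lra | apply pow_le]. nra. }
  assert (H4 : (A + INR m + 1) * t <= (A + INR m + 1) * (1 + t ^ n))
    by (apply Rmult_le_compat_l; [generalize (pos_INR m); lra | exact H1]).
  assert (H5 : B * t ^ (k + 1) <= B * (1 + t ^ n)) by now apply Rmult_le_compat_l.
  unfold D in *. nra.
Qed.

Lemma is_derive_C_quadratic (f : C -> C) (z l : C) (M : R) :
  0 <= M ->
  (forall h, Cmod h <= 1 -> Cmod (f (z + h) - f z - h * l)%C <= M * Cmod h ^ 2) ->
  is_derive (K := C_AbsRing) (V := C_NormedModule) f z l.
Proof.
  intros HM H. split; [apply is_linear_scal_l|].
  intros x Hx.
  (* [filterdiff] asks for the estimate at every limit point of the filter [locally z]; z is the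
     only one. *)
  rewrite <- (is_filter_lim_locally_unique (V := AbsRing_NormedModule C_AbsRing) z x Hx).
  clear x Hx.
  intros eps. assert (He := cond_pos eps).
  (* The 1 keeps h in the disc where the quadratic bound holds; M + 1 avoids dividing by zero when M
     = 0. *)
  assert (Hd : 0 < Rmin 1 (eps / (M + 1))).
  { apply Rmin_glb_lt; [lra | apply Rdiv_lt_0_compat; lra]. }
  apply (locally_le_locally_norm (K := C_AbsRing) (V := AbsRing_NormedModule C_AbsRing)).
  exists (mkposreal _ Hd). intros y Hy.
  change (Cmod (y - z)%C < Rmin 1 (eps / (M + 1))) in Hy.
  change (Cmod (f y - f z - (y - z) * l)%C <= eps * Cmod (y - z)%C).
  assert (H1 := Rmin_l 1 (eps / (M + 1))). assert (H2 := Rmin_r 1 (eps / (M + 1))).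
  specialize (H (y - z)%C ltac:(lra)).
  assert (E : forall u v : C, (u + (v - u))%C = v) by (intros; ring).
  rewrite (E z y) in H.
  eapply Rle_trans; [exact H|].
  assert (H0 := Cmod_ge_0 (y - z)).
  assert (Cmod (y - z) * (M + 1) <= eps).
  { apply (Rmult_le_reg_r (/ (M + 1))); [apply Rinv_0_lt_compat; lra|].
    rewrite Rmult_assoc, Rinv_r, Rmult_1_r by lra. unfold Rdiv in *. lra. }
  nra.
Qed.

Lemma Re_le_Cmod (w : C) : Re w <= Cmod w.
Proof. eapply Rle_trans; [apply Rle_abs | apply re_le_Cmod]. Qed.

Lemma INR_C_neq_0 (m : nat) : m <> O -> RtoC (INR m) <> 0%C.
Proof. intros Hm H. apply RtoC_inj in H. revert H. now apply not_0_INR. Qed.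

(** With the companion identity for [beta], this makes the derivative of the exponent in w equal to
    w^n + (-1)^(k+1) b w^k - z. *)
Lemma INR_S_alpha (k : nat) : (INR (S k) * alpha k = (- (1)) ^ (k + 1))%C.
Proof.
  unfold alpha. rewrite !Nat.add_1_r. unfold Cdiv.
  rewrite (Cmult_comm (_ ^ _)), Cmult_assoc, Cinv_r by now apply INR_C_neq_0.
  apply Cmult_1_l.
Qed.

Lemma INR_S_beta (n : nat) : (INR (S n) * beta n = 1)%C.
Proof.
  unfold beta. rewrite Nat.add_1_r. unfold Cdiv.
  rewrite Cmult_1_l, Cinv_r by now apply INR_C_neq_0. reflexivity.
Qed.

Lemma Cmod_ray (theta t : R) : 0 <= t -> Cmod (t * direction theta) = t.
Proof. intros Ht. rewrite Cmod_RtoC_mult, Cmod_direction; [ring | exact Ht]. Qed.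

Lemma beta_ray_pow (n : nat) (theta t : R) : is_ray_angle n theta ->
  (beta n * (t * direction theta) ^ (n + 1) = RtoC (- (t ^ (n + 1) / INR (n + 1))))%C.
Proof.
  intros Ht. rewrite Cpow_mult_l, direction_ray_pow by exact Ht.
  unfold beta. rewrite <- RtoC_pow, RtoC_opp, RtoC_div by (apply not_0_INR; lia).
  field. apply INR_C_neq_0. lia.
Qed.

Section Integrand.
Context (n k : nat) (b : C) (hkn : (k < n)%nat).

(** The majorant of the integrand on the rays, with A = |z| and B = |b alpha|. A and B stay free so
    that extra exponential factors can be absorbed into them. *)
Definition decay (A B t : R) : R :=
  exp (A * t + B * t ^ (k + 1) - t ^ (n + 1) / INR (n + 1)).

Lemma Cmod_integrand_le (z : C) (theta t : R) :
  is_ray_angle n theta -> 0 <= t ->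
  Cmod (integrand n k b z (t * direction theta)) <= decay (Cmod z) (Cmod (b * alpha k)) t.
Proof.
  intros Hth Ht. unfold integrand, decay. rewrite beta_ray_pow by exact Hth.
  rewrite Cmod_Cexp. apply exp_le. rewrite !re_plus, re_RtoC.
  assert (H1 := Re_le_Cmod (- (t * direction theta) * z)).
  assert (H2 := Re_le_Cmod (b * alpha k * (t * direction theta) ^ (k + 1))).
  rewrite Cmod_mult, Cmod_opp, Cmod_ray in H1 by exact Ht.
  rewrite (Cmod_mult (b * alpha k)), Cmod_pow, Cmod_ray in H2 by exact Ht.
  lra.
Qed.

Lemma ray_continuous_integrand (z : C) : ray_continuous (integrand n k b z).
Proof.
  apply (ray_continuous_Cexp
    (fun w => - w * z + b * alpha k * w ^ (k + 1) + beta n * w ^ (n + 1))%C).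
  apply ray_continuous_plus; [apply ray_continuous_plus|].
  - apply (ray_continuous_ext (fun w => (- z) * w ^ 1)%C); [intros w; simpl; ring|].
    apply ray_continuous_mult; [apply ray_continuous_const | apply ray_continuous_pow].
  - apply ray_continuous_mult; [apply ray_continuous_const | apply ray_continuous_pow].
  - apply ray_continuous_mult; [apply ray_continuous_const | apply ray_continuous_pow].
Qed.

Definition moment (m : nat) (z : C) : C :=
  contour_int n (fun w => w ^ m * integrand n k b z w)%C.

(** [contour_int] is total, so this convergence is what gives [moment] its meaning; identities and
    bounds for moments then follow from uniqueness of the integral. *)
Lemma is_contour_int_moment (m : nat) (z : C) :
  is_contour_int n (fun w => w ^ m * integrand n k b z w)%C (moment m z).
Proof.
  destruct (exp_poly_dominated n k m (Cmod z) (Cmod (b * alpha k)))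
    as [M [HM HMt]]; try lia; try apply Cmod_ge_0.
  destruct (ex_contour_int_dominated n (fun w => w ^ m * integrand n k b z w)%C M) as [l [Hl _]].
  - apply ray_continuous_mult; [apply ray_continuous_pow | apply ray_continuous_integrand].
  - intros theta t Hth Ht. rewrite Cmod_mult, Cmod_pow, Cmod_ray by exact Ht.
    eapply Rle_trans; [|apply (HMt t Ht)].
    apply Rmult_le_compat_l; [now apply pow_le|]. now apply Cmod_integrand_le.
  - unfold moment. now rewrite (is_contour_int_unique n _ l Hl).
Qed.

Lemma integrand_plus (z h w : C) :
  integrand n k b (z + h) w = (integrand n k b z w * Cexp (- (h * w)))%C.
Proof. unfold integrand. rewrite <- Cexp_plus. f_equal. ring. Qed.

Lemma decay_plus (A A' B t : R) : decay A B t * exp (A' * t) = decay (A + A') B t.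
Proof. unfold decay. rewrite <- exp_plus. f_equal. ring. Qed.

Lemma moment_quadratic (m : nat) (z : C) :
  exists M, 0 <= M /\ forall h, Cmod h <= 1 ->
    Cmod (moment m (z + h) - moment m z - h * - moment (S m) z)%C <= M * Cmod h ^ 2.
Proof.
  (* The remainder e^(-hw) - 1 + hw is at most |h|^2 t^2 e^(|h|t): t^2 raises the power to m + 2,
     and |h| <= 1 raises |z| to |z| + 1. *)
  destruct (exp_poly_dominated n k (m + 2) (Cmod z + 1) (Cmod (b * alpha k)))
    as [M [HM HMt]]; try lia; try apply Cmod_ge_0; try (generalize (Cmod_ge_0 z); lra).
  exists (2 * M). split; [lra|]. intros h Hh.
  replace (2 * M * Cmod h ^ 2) with (2 * (M * Cmod h ^ 2)) by ring.
  apply (Cmod_contour_int_le n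
    (fun w => w ^ m * integrand n k b z w * Cexp_rem 2 ((- h) * w ^ 1))%C).
  - apply ray_continuous_mult.
    + apply ray_continuous_mult; [apply ray_continuous_pow | apply ray_continuous_integrand].
    + apply ray_continuous_Cexp_rem, ray_continuous_mult;
        [apply ray_continuous_const | apply ray_continuous_pow].
  - intros theta t Hth Ht.
    rewrite Cpow_1_r, !Cmod_mult, Cmod_pow.
    assert (Hr := Cexp_rem_le_pow 2 (- h * (t * direction theta))).
    rewrite Cmod_mult, Cmod_opp in Hr. rewrite Cmod_ray in * by exact Ht.
    assert (Hi := Cmod_integrand_le z theta t Hth Ht).
    assert (Hexp : exp (Cmod h * t) <= exp (1 * t)) by (apply exp_le; nra).
    apply Rle_trans with (t ^ m * decay (Cmod z) (Cmod (b * alpha k)) t *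
      ((Cmod h * t) ^ 2 * exp (1 * t))).
    + apply Rmult_le_compat.
      * apply Rmult_le_pos; [now apply pow_le | apply Cmod_ge_0].
      * apply Cmod_ge_0.
      * apply Rmult_le_compat_l; [now apply pow_le | exact Hi].
      * eapply Rle_trans; [exact Hr|]. apply Rmult_le_compat_l; [apply pow2_ge_0 | exact Hexp].
    + replace (t ^ m * decay (Cmod z) (Cmod (b * alpha k)) t * ((Cmod h * t) ^ 2 * exp (1 * t)))
        with (Cmod h ^ 2 * (t ^ (m + 2) * (decay (Cmod z) (Cmod (b * alpha k)) t * exp (1 * t))))
        by (rewrite pow_add; ring).
      rewrite decay_plus.
      replace (M * Cmod h ^ 2 * exp (- t)) with (Cmod h ^ 2 * (M * exp (- t))) by ring.
      apply Rmult_le_compat_l; [apply pow2_ge_0 | apply (HMt t Ht)].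
  (* The error of the difference quotient, multiplied by h, is itself the contour integral of that
     remainder. *)
  - replace (moment m (z + h) - moment m z - h * - moment (S m) z)%C
      with (moment m (z + h) + - (1) * moment m z + h * moment (S m) z)%C by ring.
    apply (is_contour_int_ext n (fun w => w ^ m * integrand n k b (z + h) w
      + - (1) * (w ^ m * integrand n k b z w) + h * (w ^ S m * integrand n k b z w))%C).
    + intros w. rewrite integrand_plus. unfold Cexp_rem. simpl.
      replace (- h * (w * 1))%C with (- (h * w))%C by ring.
      replace (INR 1) with 1 by reflexivity. field.
    + apply is_contour_int_plus; [apply is_contour_int_plus|].
      * apply is_contour_int_moment.
      * apply is_contour_int_scal, is_contour_int_moment.
      * apply is_contour_int_scal, is_contour_int_moment.
Qed.

(** The constant c is carried along for the factor (-1)^m / (2 pi i) in front of the derivatives of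
    [phi]. *)
Lemma is_derive_moment (c : C) (m : nat) (z : C) :
  is_derive (K := C_AbsRing) (V := C_NormedModule) (fun z => c * moment m z)%C z
    (c * - moment (S m) z)%C.
Proof.
  destruct (moment_quadratic m z) as [M [HM H]].
  apply (is_derive_C_quadratic _ _ _ (Cmod c * M)).
  - apply Rmult_le_pos; [apply Cmod_ge_0 | exact HM].
  - intros h Hh.
    replace (c * moment m (z + h) - c * moment m z - h * (c * - moment (S m) z))%C
      with (c * (moment m (z + h) - moment m z - h * - moment (S m) z))%C by ring.
    rewrite Cmod_mult, Rmult_assoc. apply Rmult_le_compat_l; [apply Cmod_ge_0 | auto].
Qed.

Lemma moment_relation (z : C) :
  (moment n z + b * (- (1)) ^ (k + 1) * moment k z - z * moment 0 z = 0)%C.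
Proof.
  (* One contour integral is evaluated twice: by linearity it is the combination of moments, and as
     the integral of an exact derivative it is 0. *)
  apply (is_contour_int_eq n
    (fun w => (w ^ n + b * (- (1)) ^ (k + 1) * w ^ k + - z * w ^ 0) * integrand n k b z w)%C).
  - replace (moment n z + b * (- (1)) ^ (k + 1) * moment k z - z * moment 0 z)%C
      with (moment n z + b * (- (1)) ^ (k + 1) * moment k z + - z * moment 0 z)%C by ring.
    apply (is_contour_int_ext n (fun w => w ^ n * integrand n k b z w
      + b * (- (1)) ^ (k + 1) * (w ^ k * integrand n k b z w)
      + - z * (w ^ 0 * integrand n k b z w))%C).
    + intros w. ring.
    + apply is_contour_int_plus; [apply is_contour_int_plus|].
      * apply is_contour_int_moment.
      * apply is_contour_int_scal, is_contour_int_moment.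
      * apply is_contour_int_scal, is_contour_int_moment.
  - destruct (exp_poly_dominated n k 0 (Cmod z) (Cmod (b * alpha k)))
      as [M [HM HMt]]; try lia; try apply Cmod_ge_0.
    apply (is_contour_int_derive n (integrand n k b z) _ M).
    + intros theta t. set (u := direction theta). unfold integrand.
      replace ((((t * u) ^ n + b * (- (1)) ^ (k + 1) * (t * u) ^ k + - z * (t * u) ^ 0) *
          Cexp (- (t * u) * z + b * alpha k * (t * u) ^ (k + 1) + beta n * (t * u) ^ (n + 1))) * u)%C
        with ((- u * z + INR (S k) * t ^ k * (b * alpha k * u ^ S k)
          + INR (S n) * t ^ n * (beta n * u ^ S n)) *
          Cexp (- (t * u) * z + b * alpha k * (t * u) ^ (k + 1) + beta n * (t * u) ^ (n + 1)))%C.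
      * apply (is_derive_Cexp_comp (fun s : R => - (s * u) * z + b * alpha k * (s * u) ^ (k + 1)
          + beta n * (s * u) ^ (n + 1))%C).
        apply (is_derive_ext (V := C_R_NormedModule) (fun s : R => s * (- u * z)
          + s ^ S k * (b * alpha k * u ^ S k) + s ^ S n * (beta n * u ^ S n))%C).
        { intros s. rewrite !Nat.add_1_r, !Cpow_mult_l. C_eq. ring. }
        apply (is_derive_plus (V := C_R_NormedModule)); [apply (is_derive_plus (V := C_R_NormedModule))|].
        -- apply is_derive_line.
        -- apply is_derive_line_pow.
        -- apply is_derive_line_pow.
      * generalize (Cexp (- (t * u) * z + b * alpha k * (t * u) ^ (k + 1)
          + beta n * (t * u) ^ (n + 1))). intros e.
        rewrite !Cpow_mult_l, <- INR_S_alpha, !Cpow_S.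
        transitivity ((- u * z + INR (S k) * alpha k * t ^ k * b * u * u ^ k
          + INR (S n) * beta n * t ^ n * u * u ^ n) * e)%C; [ring|].
        rewrite INR_S_beta. simpl (_ ^ 0)%C. ring.
    + apply ray_continuous_mult; [|apply ray_continuous_integrand].
      apply ray_continuous_plus; [apply ray_continuous_plus; [apply ray_continuous_pow|]|];
        (apply ray_continuous_mult; [apply ray_continuous_const | apply ray_continuous_pow]).
    + intros theta t Hth Ht. eapply Rle_trans; [now apply Cmod_integrand_le|].
      generalize (HMt t Ht). now rewrite pow_O, Rmult_1_l.
Qed.

(** * The differential equation for [phi] *)

Definition two_pi_i : C := (2 * PI * Ci)%C.

Lemma two_pi_i_neq_0 : two_pi_i <> 0%C.
Proof.
  intros H. apply (f_equal snd) in H. unfold two_pi_i in H. simpl in H.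
  generalize PI_RGT_0. lra.
Qed.

Lemma phi_moment (z : C) : phi n k b z = (1 / two_pi_i * moment 0 z)%C.
Proof.
  unfold phi. fold two_pi_i. f_equal. apply is_contour_int_unique.
  apply (is_contour_int_ext n (fun w => w ^ 0 * integrand n k b z w)%C).
  - intros w. simpl. ring.
  - apply is_contour_int_moment.
Qed.

Lemma C_derive_n_phi (m : nat) (z : C) :
  C_derive_n (phi n k b) m z = (1 / two_pi_i * (- (1)) ^ m * moment m z)%C.
Proof.
  revert z. induction m as [|m IH]; intros z.
  - simpl. rewrite phi_moment. ring.
  - simpl C_derive_n. apply is_C_derive_unique.
    apply (is_derive_ext (K := C_AbsRing) (V := C_NormedModule)
      (fun z => 1 / two_pi_i * (- (1)) ^ m * moment m z)%C).
    + intros y. symmetry. apply IH.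
    + replace (1 / two_pi_i * (- (1)) ^ S m * moment (S m) z)%C
        with (1 / two_pi_i * (- (1)) ^ m * - moment (S m) z)%C by (rewrite Cpow_S; ring).
      apply is_derive_moment.
Qed.

Lemma entire_C_derive_n_phi (m : nat) : entire (C_derive_n (phi n k b) m).
Proof.
  intros z. eexists. apply (is_derive_ext (K := C_AbsRing) (V := C_NormedModule)
      (fun z => 1 / two_pi_i * (- (1)) ^ m * moment m z)%C).
  - intros y. symmetry. apply C_derive_n_phi.
  - apply is_derive_moment.
Qed.

Lemma phi_solution : is_solution n k b (phi n k b).
Proof.
  split; [exact (entire_C_derive_n_phi 0)|].
  split; [intros m _; apply entire_C_derive_n_phi|].
  intros z. rewrite !C_derive_n_phi, phi_moment.
  (* Since (-1)^(n+1) (-1)^k = (-1)^n (-1)^(k+1), the common factor (-1)^n leaves exactly the left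
     side of [moment_relation]. *)
  transitivity (1 / two_pi_i * (- (1)) ^ n *
    (moment n z + b * (- (1)) ^ (k + 1) * moment k z - z * moment 0 z))%C.
  - rewrite !Cpow_add_r, !Cpow_1_r. ring.
  - rewrite moment_relation. ring.
Qed.

End Integrand.

(** * Nontriviality *)

(** On [0,1] the exponent is at least -1 and the integrand is positive throughout, so partial
    integrals beyond 1 are at least e^(-1). This rules out a limit K <= 0. *)
Lemma stretched_exp_int (n : nat) : (0 < n)%nat ->
  exists K, 0 < K /\
    is_RInt_gen (fun t => exp (- (t ^ (n + 1) / INR (n + 1)))) (at_point 0)
      (Rbar_locally p_infty) K.
Proof.
  intros Hn. set (f := fun t => exp (- (t ^ (n + 1) / INR (n + 1)))).
  assert (HN : 1 <= INR (n + 1)) by (apply (le_INR 1); lia).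
  assert (Hc : forall t, continuous f t).
  { intros t. apply (ex_derive_continuous (V := R_NormedModule)). unfold f. auto_derive. lra. }
  destruct (exp_poly_dominated n 0 0 0 0) as [M [HM HMt]]; try lia; try lra.
  destruct (ex_RInt_gen_exp_dominated (V := R_CompleteNormedModule) f M Hc) as [K [HK _]].
  { intros t Ht. change (Rabs (f t) <= M * exp (- t)).
    rewrite Rabs_pos_eq by (left; apply exp_pos).
    eapply Rle_trans; [|apply (HMt t Ht)]. rewrite pow_O, Rmult_1_l.
    right. unfold f. f_equal. ring. }
  exists K. split; [|exact HK].
  assert (Hex : forall a b, ex_RInt f a b).
  { intros a b. apply (ex_RInt_continuous (V := R_CompleteNormedModule)). intros; apply Hc. }
  assert (Hlow : forall x, 1 <= x -> exp (- 1) <= RInt f 0 x).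
  { intros x Hx. rewrite <- (RInt_Chasles f 0 1 x) by apply Hex.
    assert (0 <= RInt f 1 x).
    { apply RInt_ge_0; [exact Hx | apply Hex | intros; left; apply exp_pos]. }
    assert (exp (- 1) <= RInt f 0 1).
    { replace (exp (- 1)) with (RInt (fun _ : R => exp (- 1)) 0 1).
      - apply RInt_le; [lra | apply ex_RInt_const | apply Hex |].
        intros t Ht. apply exp_le.
        assert (Hp : 0 <= t ^ (n + 1) <= 1).
        { split; [apply pow_le; lra|].
          apply Rle_trans with (1 ^ (n + 1)); [apply pow_incr; lra | rewrite pow1; lra]. }
        apply Ropp_le_cancel. rewrite Ropp_involutive.
        apply Rle_div_l; lra.
      - rewrite RInt_const. unfold scal; simpl. unfold mult; simpl. ring. }
    change (exp (- 1) <= RInt f 0 1 + RInt f 1 x). lra. }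
  destruct (Rlt_le_dec 0 K) as [H|H]; [exact H|exfalso].
  assert (He := exp_pos (- 1)).
  destruct (HK (fun y => y < exp (- 1))) as [Q P HQ [N HP] HQP].
  - apply (open_lt (exp (- 1))). lra.
  - destruct (HQP 0 (Rmax 1 (N + 1))) as [y [Hy1 Hy2]].
    + exact HQ.
    + apply HP. generalize (Rmax_r 1 (N + 1)). lra.
    + simpl in Hy1. apply (is_RInt_unique (V := R_CompleteNormedModule)) in Hy1.
      generalize (Hlow (Rmax 1 (N + 1)) (Rmax_l _ _)). lra.
Qed.

Lemma contour_int_beta_neq_0 (n : nat) (l : C) : (0 < n)%nat ->
  is_contour_int n (fun w => Cexp (beta n * w ^ (n + 1)))%C l -> l <> 0%C.
Proof.
  intros Hn Hl. destruct (stretched_exp_int n Hn) as [K [HK HI]].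
  assert (H : forall theta, is_ray_angle n theta ->
    is_RInt_gen (V := C_R_NormedModule)
      (ray_pullback (fun w => Cexp (beta n * w ^ (n + 1)))%C theta)
      (at_point 0) (Rbar_locally p_infty) (K * direction theta)%C).
  { intros theta Hth.
    assert (Hscal : forall r : R, scal r (direction theta : C_R_NormedModule) = (r * direction theta)%C).
    { intros r. unfold scal; simpl. unfold prod_scal, scal; simpl.
      unfold mult, Cmult; simpl. f_equal; ring. }
    rewrite <- Hscal.
    assert (HL := is_RInt_gen_linear (U := R_NormedModule) (V := C_R_NormedModule) _ _ _ _ _
      (is_linear_scal_l (direction theta : C_R_NormedModule)) HI).
    revert HL. apply (is_RInt_gen_ext (V := C_R_NormedModule)).
    apply filter_forall. intros ab t _. rewrite Hscal.
    unfold ray_pullback. fold (direction theta). rewrite beta_ray_pow by exact Hth.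
    f_equal. unfold Cexp; simpl. rewrite cos_0, sin_0. unfold RtoC. f_equal; ring. }
  rewrite (is_contour_int_eq n _ l (K * direction (ray_angle n) - K * direction (- ray_angle n))%C Hl).
  - rewrite !direction_value, cos_neg, sin_neg. intros E.
    apply (f_equal snd) in E. simpl in E.
    (* n > 0 puts the angle strictly between 0 and pi; for n = 0 the two rays would coincide and
       their contributions cancel. *)
    assert (Hs : 0 < sin (ray_angle n)).
    { assert (HN : 1 < INR (n + 1)) by (apply (lt_INR 1); lia).
      assert (HP := PI_RGT_0). unfold ray_angle. apply sin_gt_0.
      - apply Rdiv_lt_0_compat; lra.
      - apply (Rmult_lt_reg_r (INR (n + 1))); [lra|]. unfold Rdiv.
        rewrite Rmult_assoc, Rinv_l by lra. nra. }
    nra.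
  - eexists; eexists. split; [apply H; now left|]. split; [apply H; now right | reflexivity].
Qed.

Lemma Rle_geom_0 (x M : R) : (forall N, x <= M * (/ 2) ^ N) -> x <= 0.
Proof.
  intros H.
  apply (is_lim_seq_le (fun _ => x) (fun N => M * (/ 2) ^ N) x (M * 0)) in H.
  - simpl in H. lra.
  - apply is_lim_seq_const.
  - apply (is_lim_seq_scal_l (fun N => (/ 2) ^ N) M 0). apply is_lim_seq_geom.
    rewrite Rabs_pos_eq; lra.
Qed.

Section Nontrivial.
Context (n k : nat) (b : C) (hkn : (k < n)%nat).

(** The induction differentiates in z, so vanishing must be carried for all z although only z = 0 is
    used afterwards. *)
Lemma moment_0_of_phi_0 :
  (forall z, phi n k b z = 0%C) -> forall m z, moment n k b m z = 0%C.
Proof.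
  intros H m. induction m as [|m IH]; intros z.
  - specialize (H z). rewrite phi_moment in H by assumption.
    replace (moment n k b 0 z) with (two_pi_i * (1 / two_pi_i * moment n k b 0 z))%C
      by (field; apply two_pi_i_neq_0).
    rewrite H. ring.
  - assert (H1 := is_derive_moment n k b hkn 1 m z).
    apply is_C_derive_unique in H1.
    assert (H2 : C_derive (fun z => 1 * moment n k b m z)%C z = 0%C).
    { apply is_C_derive_unique.
      apply (is_derive_ext (K := C_AbsRing) (V := C_NormedModule) (fun _ => RtoC 0)).
      - intros y. rewrite IH. symmetry. apply Cmult_0_r.
      - apply (is_derive_const (K := C_AbsRing) (V := C_NormedModule)). }
    assert (H3 := eq_trans (eq_sym H1) H2).
    replace (moment n k b (S m) z) with (- (1 * - moment n k b (S m) z))%C by ring.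
    rewrite H3. ring.
Qed.

(** The term of degree j contributes a multiple of the moment of index (k+1)j. *)
Lemma is_contour_int_Cexp_sum (c : C) (N : nat) :
  (forall m, moment n k b m 0 = 0%C) ->
  is_contour_int n (fun w => Cexp_sum N (c * w ^ (k + 1)) * integrand n k b 0 w)%C 0.
Proof.
  intros H. induction N as [|N IH].
  - assert (H0 := is_contour_int_scal n 0 _ _ (is_contour_int_moment n k b hkn 0 0)).
    rewrite H, Cmult_0_l in H0. revert H0. apply is_contour_int_ext.
    intros w. simpl. ring.
  - assert (HN := is_contour_int_plus n _ _ _ _ IH
      (is_contour_int_scal n (c ^ N / INR (fact N)) _ _
        (is_contour_int_moment n k b hkn ((k + 1) * N) 0))).
    rewrite H, Cmult_0_r, Cplus_0_r in HN. revert HN. apply is_contour_int_ext.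
    intros w. simpl Cexp_sum. rewrite Cpow_mult_l, Cpow_mult_r. unfold Cdiv. ring.
Qed.

Lemma phi_nontrivial : exists z, phi n k b z <> 0%C.
Proof.
  apply NNPP. intros Hno.
  assert (Hphi : forall z, phi n k b z = 0%C).
  { intros z. apply NNPP. intros Hz. apply Hno. now exists z. }
  assert (Hmom : forall m, moment n k b m 0 = 0%C)
    by (intros m; now apply moment_0_of_phi_0).
  set (c := (b * alpha k)%C).
  assert (Hc := Cmod_ge_0 c).
  (* 3 = 2 + 1: the Taylor remainder costs e^(2|c|t^(k+1)), and the integrand at z = 0 another
     e^(|c|t^(k+1)). *)
  destruct (exp_poly_dominated n k 0 0 (3 * Cmod c)) as [M [HM HMt]]; try lia; try lra.
  assert (Hrem : forall N, exists l, Cmod l <= 2 * (M * (/ 2) ^ N) /\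
    is_contour_int n (fun w => Cexp (beta n * w ^ (n + 1)))%C l).
  { intros N.
    destruct (ex_contour_int_dominated n
      (fun w => Cexp_rem N (- c * w ^ (k + 1)) * integrand n k b 0 w)%C (M * (/ 2) ^ N))
      as [l [Hl Bl]].
    - apply ray_continuous_mult; [|now apply ray_continuous_integrand].
      apply ray_continuous_Cexp_rem, ray_continuous_mult;
        [apply ray_continuous_const | apply ray_continuous_pow].
    - intros theta t Hth Ht. rewrite Cmod_mult.
      assert (Hr := Cexp_rem_le_geom N (- c * (t * direction theta) ^ (k + 1))).
      rewrite Cmod_mult, Cmod_opp, Cmod_pow, Cmod_ray in Hr by exact Ht.
      assert (Hi := Cmod_integrand_le n k b 0 theta t Hth Ht).
      fold c in Hi. rewrite Cmod_0 in Hi.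
      eapply Rle_trans; [apply Rmult_le_compat; [apply Cmod_ge_0 | apply Cmod_ge_0 | exact Hr | exact Hi]|].
      replace (M * (/ 2) ^ N * exp (- t)) with ((/ 2) ^ N * (M * exp (- t))) by ring.
      rewrite Rmult_assoc. apply Rmult_le_compat_l; [apply pow_le; lra|].
      eapply Rle_trans; [|apply (HMt t Ht)]. rewrite pow_O, Rmult_1_l.
      unfold decay. rewrite <- exp_plus. right. f_equal. ring.
    - exists l. split; [exact Bl|].
      (* The Taylor polynomial contributes 0, so the remainder alone carries the whole integral of
         exp(beta w^(n+1)). *)
      replace l with (0 + l)%C by ring.
      apply (is_contour_int_ext n (fun w => Cexp_sum N (- c * w ^ (k + 1)) * integrand n k b 0 w
        + Cexp_rem N (- c * w ^ (k + 1)) * integrand n k b 0 w)%C).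
      + intros w. unfold Cexp_rem.
        transitivity (Cexp (- c * w ^ (k + 1)) * integrand n k b 0 w)%C; [ring|].
        unfold integrand. rewrite <- Cexp_plus. f_equal. unfold c. ring.
      + apply is_contour_int_plus; [now apply is_contour_int_Cexp_sum | exact Hl]. }
  (* The integral does not depend on N, so uniqueness lets this one value satisfy the bound for
     every N. *)
  destruct (Hrem O) as [l [_ Hl]].
  apply (contour_int_beta_neq_0 n l); [lia | exact Hl |].
  apply Cmod_eq_0. apply Rle_antisym; [|apply Cmod_ge_0].
  apply (Rle_geom_0 _ (2 * M)). intros N.
  destruct (Hrem N) as [l' [Bl' Hl']].
  rewrite (is_contour_int_eq n _ l l' Hl Hl'). lra.
Qed.

End Nontrivial.

Open Scope C_scope.
Theorem theorem1 (n k : nat) (b : C) (hk : (0 < k)%nat) (hkn : (k < n)%nat) :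
  (forall z : C, ex_contour_int n (integrand n k b z)) /\
  is_solution n k b (phi n k b) /\
  (exists z : C, phi n k b z <> 0).
Proof.
  split; [|split; [now apply phi_solution | now apply phi_nontrivial]].
  intros z. apply (is_contour_int_ex n _ (moment n k b 0 z)).
  apply (is_contour_int_ext n (fun w => w ^ 0 * integrand n k b z w)%C).
  - intros w. simpl. ring.
  - now apply is_contour_int_moment.
Qed.
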